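(* There exists a constant $c>0$ such that for all sufficiently large $n\in\mathbb{N}$ there exists an $n$-vertex $3$-uniform generalised hedgehog $H^*$ with \[R(H^* )\ \ge\ c\,\frac{n^{3/2}}{\log n}.\] In particular, $H^*$ is a $1$-degenerate $3$-uniform hypergraph on $n$ vertices whose $2$-colour Ramsey number is not $O(n)$.
   Context: A $3$-graph is a $3$-uniform hypergraph. For $3$-graphs $G,H$, the ($2$-colour) Ramsey number $R(G,H)$ is the least $N$ such that every colouring of the edges of the complete $3$-graph on $N$ vertices with red and blue contains a blue copy of $G$ or a red copy of $H$; $R(G)=R(G,G)$. The degree of a vertex is the number of edges containing it; a hypergraph is $D$-degenerate if every subhypergraph has a vertex of degree at most $D$ in that subhypergraph. A (generalised) hedgehog is a $3$-graph on vertex set $B\sqcup S$ ($B$ the body, $S$ the spikes) in which every edge consists of one spike and two body vertices, and every spike lies in exactly one edge (different spikes may be attached to the same pair of body vertices, and some pairs of body vertices may have no spike). Every generalised hedgehog is $1$-degenerate. *)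

(* Defs.v *)
From mathcomp Require Import all_boot.
From Stdlib Require Import Reals ClassicalEpsilon.
Set Implicit Arguments. Unset Strict Implicit. Unset Printing Implicit Defensive.

Definition is_3graph (V : finType) (E : {set {set V}}) : Prop :=
  forall e, e \in E -> #|e| = 3.

Definition gen_hedgehog (V : finType) (E : {set {set V}}) : Prop :=
  exists B : {set V},
    (forall e, e \in E -> #|e :&: B| = 2 /\ #|e :\: B| = 1) /\
    (forall s, s \notin B -> #|[set e in E | s \in e]| = 1).

(* A 2-colouring of the edges of the complete 3-graph on vertex set 'I_N:
   true = blue, false = red (only values on 3-sets matter). *)
Definition mono_copy (N : nat) (col : {set 'I_N} -> bool) (b : bool)
  (V : finType) (E : {set {set V}}) : Prop :=
  exists f : V -> 'I_N, injective f /\ forall e, e \in E -> col (f @: e) = b.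

Definition ramsey_prop (N : nat) (V1 : finType) (E1 : {set {set V1}})
  (V2 : finType) (E2 : {set {set V2}}) : Prop :=
  forall col : {set 'I_N} -> bool,
    mono_copy col true E1 \/ mono_copy col false E2.

Definition ramsey_predb V1 (E1 : {set {set V1}}) V2 (E2 : {set {set V2}})
  : pred nat :=
  fun N => if excluded_middle_informative (ramsey_prop N E1 E2) then true else false.

(* R(G,H): least N with the arrow property (0 if none exists, which never
   happens by Ramsey's theorem). *)
Definition ramsey2 V1 (E1 : {set {set V1}}) V2 (E2 : {set {set V2}}) : nat :=
  match excluded_middle_informative (exists N, ramsey_predb E1 E2 N) with
  | left ex => ex_minn ex
  | right _ => 0
  end.

Definition ramsey V (E : {set {set V}}) : nat := ramsey2 E E.

(* Main.v *)
Require Import Defs.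
From mathcomp Require Import all_boot zify.
From Stdlib Require Import Reals Lra ClassicalEpsilon.
(* [Reals] shadows [family] and rebinds [^] on [nat] to [Nat.pow]. *)
From mathcomp Require Import ssrnat finfun.

(** Let [Y] be a graph on [M] vertices with maximum degree at most [D], without
    a clique of size 16 and without an independent set of size [b], and call a
    triple blue when it contains an edge of [Y].  Take the hedgehog whose body
    is a clique on [b] vertices, each pair carrying a spike, in which moreover
    each pair among 16 chosen body vertices carries [m > 2D] spikes.  In a blue
    copy one of these heavy pairs [{x, y}] is not an edge of [Y], so its [m]
    spikes all lie in the union of the neighbourhoods of [x] and [y], which is
    too small.  In a red copy the body contains an edge of [Y], and no triple
    containing that edge is red.

    With [b] of order [sqrt n] and [m], [D] of order [n], a random graph of
    density [1/q], [q] of order [b / log n], has these properties on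
    [M] of order [q D = n^(3/2) / log n] vertices, once its vertices of large
    degree are discarded.  As [ramsey] is [0] by convention when no [N] has the
    arrow property, the finite Ramsey theorem is needed as well. *)

Set Implicit Arguments. Unset Strict Implicit. Unset Printing Implicit Defensive.

(** * The finite Ramsey theorem, and how lower bounds on [ramsey] follow *)

Lemma subset_of_card (T : finType) (A : {set T}) k :
  k <= #|A| -> exists2 B : {set T}, B \subset A & #|B| = k.
Proof.
case/card_geqP=> s [us szs sA]; exists [set x in s].
  by apply/subsetP=> x; rewrite inE => /sA.
by rewrite cardsE (card_uniqP us).
Qed.

(** Induction on [k], then on [s + t]. Remove a vertex [x] and colour each [k]-set [e] by the colour
    of [x |: e]: a large set [B'] is homogeneous for this, of colour [c]. Recursion inside [B'] with
    the target for [c] lowered by one yields either a set of the other colour or one that [x]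
    completes. *)
Lemma hypergraph_ramsey k s t : exists N, forall (T : finType)
    (col : {set T} -> bool) (A : {set T}), N <= #|A| ->
  exists c (B : {set T}), [/\ B \subset A, #|B| = (if c then s else t) &
    forall e : {set T}, e \subset B -> #|e| = k -> col e = c].
Proof.
elim: k s t => [|k IHk] s t.
  exists (maxn s t) => T col A hA.
  have /subset_of_card[B BA cB] : (if col set0 then s else t) <= #|A|.
    by case: (col set0); lia.
  exists (col set0), B; split=> // e _ /eqP.
  by rewrite cards_eq0 => /eqP->.
have [n] := ubnP (s + t); elim: n s t => // n IHn [|s] [|t] lt_n.
- exists 0 => T col A _; exists true, set0; rewrite sub0set cards0; split=> // e.
  by rewrite subset0 => /eqP->; rewrite cards0.
- exists 0 => T col A _; exists true, set0; rewrite sub0set cards0; split=> // e.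
  by rewrite subset0 => /eqP->; rewrite cards0.
- exists 0 => T col A _; exists false, set0; rewrite sub0set cards0; split=> // e.
  by rewrite subset0 => /eqP->; rewrite cards0.
have [|p hp] := IHn s t.+1; first lia.
have [|q hq] := IHn s.+1 t; first lia.
have [N hN] := IHk p q.
exists N.+1 => T col A hA.
have /card_gt0P[x xA] : 0 < #|A| by lia.
have {}hA : N <= #|A :\ x| by move: hA; rewrite (cardsD1 x) xA.
have [c [B' [sB' cB' homB']]] := hN T (fun e => col (x |: e)) _ hA.
have [sB'A xB'] : B' \subset A /\ x \notin B'.
  split; first exact: subset_trans sB' (subsetDl _ _).
  by apply/negP=> /(subsetP sB'); rewrite !inE eqxx.
have extend (B : {set T}) : B \subset B' ->
    (forall e : {set T}, e \subset B -> #|e| = k.+1 -> col e = c) ->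
    forall e : {set T}, e \subset x |: B -> #|e| = k.+1 -> col e = c.
  move=> sB homB e se ce; have [xe|xe] := boolP (x \in e); last first.
    apply: homB => //; apply/subsetP=> y ye.
    have := subsetP se _ ye; rewrite !inE => /orP[/eqP yx|//].
    by rewrite -yx ye in xe.
  rewrite -(setD1K xe); apply: homB'; last by move: ce; rewrite (cardsD1 x) xe; lia.
  apply: subset_trans sB; apply/subsetP=> y; rewrite !inE => /andP[/negPf yx ye].
  by have := subsetP se _ ye; rewrite !inE yx.
have glue (B : {set T}) : B \subset B' -> x |: B \subset A /\ #|x |: B| = #|B|.+1.
  move=> sB; split; first by rewrite subUset sub1set xA (subset_trans sB).
  by rewrite cardsU1 (contra (subsetP sB x)).
(* Only the target for colour [c] is one short of the goal; the Booleans in the sizes encode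
   this. *)
have [d [B [sB cB homB]]] : exists d (B : {set T}), [/\ B \subset B',
    #|B| = (if d then s + ~~ c else t + c) &
    forall e : {set T}, e \subset B -> #|e| = k.+1 -> col e = d].
  case: c cB' {homB' extend} => cB'.
    have [|d [B [? cB homB]]] := hp T col B'; first by rewrite cB'.
    by exists d, B; split=> //; rewrite cB; case: (d); lia.
  have [|d [B [? cB homB]]] := hq T col B'; first by rewrite cB'.
  by exists d, B; split=> //; rewrite cB; case: (d); lia.
have [eq_dc|neq_dc] := eqVneq d c.
  exists c, (x |: B); rewrite eq_dc in homB cB; have [-> ->] := glue B sB.
  by split=> //; [rewrite cB; case: (c); lia | exact: extend].
exists d, B; split=> //; first exact: subset_trans sB sB'A.
by rewrite cB; case: (d) (c) neq_dc => [] [] //; lia.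
Qed.

Lemma ramsey_prop_exists (V : finType) (E : {set {set V}}) :
  is_3graph E -> exists N, ramsey_prop N E E.
Proof.
move=> E3; have [N hN] := hypergraph_ramsey 3 #|V| #|V|.
exists N => col; have [|c [B [_ cB homB]]] := hN _ col setT.
  by rewrite cardsT card_ord.
have {}cB : #|V| = #|B| by rewrite cB; case: (c).
pose f (v : V) := enum_val (cast_ord cB (enum_rank v)).
have f_inj : injective f by move=> u v /enum_val_inj /cast_ord_inj /enum_rank_inj.
have hcopy : mono_copy col c E.
  exists f; split=> // e eE; apply: homB; last by rewrite card_imset // E3.
  by apply/subsetP=> _ /imsetP[v _ ->]; exact: enum_valP.
by case: c {homB} hcopy; [left | right].
Qed.

Lemma ramsey_prop_mono N N' (V1 V2 : finType) (E1 : {set {set V1}})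
    (E2 : {set {set V2}}) :
  N <= N' -> ramsey_prop N E1 E2 -> ramsey_prop N' E1 E2.
Proof.
move=> leN hN col; pose w := widen_ord leN.
have w_inj : injective w by move=> i j /(congr1 val) /= /val_inj.
have lift_copy c (V : finType) (E : {set {set V}}) :
    mono_copy (fun e => col (w @: e)) c E -> mono_copy col c E.
  case=> f [f_inj homf]; exists (w \o f); split; first exact: inj_comp.
  by move=> e eE; rewrite imset_comp homf.
by case: (hN (fun e => col (w @: e))) => /lift_copy; [left | right].
Qed.

(** The finite Ramsey theorem excludes the default value [0]; by monotonicity, the least arrowing
    number cannot be at most a failing [N]. *)
Lemma ramsey_lower_bound (V : finType) (E : {set {set V}}) N :
  is_3graph E -> ~ ramsey_prop N E E -> N < ramsey E.
Proof.
move=> E3 notN; have predP M : ramsey_predb E E M <-> ramsey_prop M E E.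
  by rewrite /ramsey_predb; case: excluded_middle_informative.
rewrite /ramsey /ramsey2; case: excluded_middle_informative => [ex|[]]; last first.
  by have [M hM] := ramsey_prop_exists E3; exists M; apply/predP.
case: ex_minnP => M /predP hM _; rewrite ltnNge; apply/negP=> leMN.
exact/notN/(ramsey_prop_mono leMN).
Qed.

(** * Random graphs of bounded degree, by counting *)

Lemma card_fixed_on (I J : finType) (S : {set I}) (A : {set J}) :
  #|[set f : {ffun I -> J} | [forall x in S, f x \in A]]| * #|J| ^ #|S| =
  #|A| ^ #|S| * #|J| ^ #|I|.
Proof.
pose F (x : I) := [pred y : J | (x \in S) ==> (y \in A)].
have -> : #|[set f : {ffun I -> J} | [forall x in S, f x \in A]]| = #|family F|.
  by apply: eq_card => f; rewrite !inE.
(* The count is a product over the points of [I]: [#|A|] choices on [S], [#|J|] elsewhere. The extra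
   factor [#|J| ^ #|S|] avoids the division in the probability [(#|A| / #|J|) ^ #|S|]. *)
rewrite card_family foldrE big_map big_enum /=.
rewrite (bigID (mem S)) /=.
rewrite (eq_bigr (fun=> #|A|)); last first.
  by move=> x xS; apply: eq_card => y; rewrite unfold_in xS.
rewrite [X in _ * X * _](eq_bigr (fun=> #|J|)); last first.
  by move=> x /negPf xS; apply: eq_card => y; rewrite unfold_in xS.
rewrite !prod_nat_const -mulnA -expnD; congr (_ * _ ^ _).
by rewrite addnC -(cardC (mem S)).
Qed.

Lemma card_bigcup_leq (I T : finType) (P : pred I) (F : I -> {set T}) k :
  (forall i, P i -> #|F i| <= k) -> #|\bigcup_(i | P i) F i| <= #|P| * k.
Proof.
move=> leF; apply: (@leq_trans (\sum_(i | P i) #|F i|)); last first.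
  by rewrite -sum_nat_const; apply: leq_sum.
elim/big_rec2: _ => [|i n B _ leB]; first by rewrite cards0.
by apply: leq_trans (leq_card_setU _ _) _; rewrite leq_add2l.
Qed.

Lemma bin_leq_expn n k : 'C(n, k) <= n ^ k.
Proof.
have leF : n ^_ k <= n ^ k.
  elim: k => // k IHk; rewrite ffactnSr expnSr; apply: leq_mul => //.
  exact: leq_subr.
by apply: leq_trans leF; rewrite -bin_ffact leq_pmulr // fact_gt0.
Qed.

Section RandomGraph.
Variables (T : finType) (q : nat).
Local Notation weighting := {ffun {set T} -> 'I_q.+1}.
Implicit Types (w : weighting) (A : {set T}).

Definition pairs A : {set {set T}} := [set e : {set T} | e \subset A & #|e| == 2].

(** Union bound over the [k]-sets. It serves for cliques with [C] the zero weight, and for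
    independent sets with [C] its complement. *)
Lemma card_constant_on_pairs (C : {set 'I_q.+1}) k :
  4 * (#|T| ^ k * #|C| ^ 'C(k, 2)) <= q.+1 ^ 'C(k, 2) ->
  4 * #|\bigcup_(A : {set T} | #|A| == k)
     [set w : weighting | [forall e in pairs A, w e \in C]]| <= #|{: weighting}|.
Proof.
move=> hk; set U := \bigcup_(A | _) _.
rewrite -(leq_pmul2r (_ : 0 < q.+1 ^ 'C(k, 2))) ?expn_gt0 //.
(* The bound for a single [A] must be a natural number, hence the quotient; multiplying back by the
   divisor only decreases the numerator. *)
have : #|U| <= 'C(#|T|, k) * (#|C| ^ 'C(k, 2) * #|{: weighting}| %/ q.+1 ^ 'C(k, 2)).
  rewrite -card_draws cardsE; apply: card_bigcup_leq => A /eqP cA.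
  rewrite leq_divRL ?expn_gt0 //.
  have := card_fixed_on (pairs A) C; rewrite cards_draws cA !card_ord card_ffun.
  by rewrite card_ord => ->.
move/(leq_mul (leqnn (4 * q.+1 ^ 'C(k, 2)))) => hU.
have -> : 4 * #|U| * q.+1 ^ 'C(k, 2) = 4 * q.+1 ^ 'C(k, 2) * #|U| by lia.
apply: (leq_trans hU); rewrite [X in _ <= X]mulnC.
apply: (leq_trans _ (leq_mul hk (leqnn _))).
set Q := #|{: weighting}|; set p := q.+1 ^ _; set c := #|C| ^ _.
have := leq_divM (c * Q) p; have := bin_leq_expn #|T| k.
move: (c * Q %/ p) => d h1 h2.
apply: (@leq_trans (4 * 'C(#|T|, k) * (d * p))); first lia.
apply: (@leq_trans (4 * #|T| ^ k * (c * Q))); last lia.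
by apply: leq_mul; rewrite ?leq_mul2l.
Qed.

(** Under a uniform weighting each pair is an edge with probability [1 / q.+1], so plain
    cardinalities stand for probabilities. *)
Definition random_edge w : rel T := fun x y => (x != y) && (w [set x; y] == ord0).

Lemma sum_degrees :
  (\sum_(w : weighting) \sum_x #|[set y | random_edge w x y]|) * q.+1
    <= #|T| ^ 2 * #|{: weighting}|.
Proof.
have pair_count x y : #|[set w | random_edge w x y]| * q.+1 <= #|{: weighting}|.
  have [<-|neq_xy] := eqVneq x y.
    by rewrite (_ : [set _ | _] = set0) ?cards0 //; apply/setP=> w; rewrite !inE /random_edge eqxx.
  have := card_fixed_on [set [set x; y]] [set ord0 : 'I_q.+1].
  rewrite !cards1 !card_ord !expn1 mul1n card_ffun card_ord => <-.
  rewrite leq_mul2r; apply/orP; right; apply/subset_leq_card/subsetP=> w.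
  rewrite !inE => /andP[_ w0]; apply/forallP=> e; apply/implyP.
  by rewrite !inE => /eqP->.
rewrite exchange_big /=.
have -> : \sum_x \sum_w #|[set y | random_edge w x y]| = \sum_x \sum_y #|[set w | random_edge w x y]|.
  apply: eq_bigr => x _.
  transitivity (\sum_(w : weighting) \sum_y (random_edge w x y : nat)).
    by apply: eq_bigr => w _; rewrite -sum1dep_card big_mkcond.
  rewrite exchange_big /=; apply: eq_bigr => y _.
  by rewrite -sum1dep_card [RHS]big_mkcond.
rewrite big_distrl /= -mulnn -mulnA -[X in _ <= X]sum_nat_const.
apply: leq_sum => x _; rewrite big_distrl /= -[X in _ <= X]sum_nat_const.
exact: leq_sum.
Qed.

(** Each of three bad events (a clique, an independent set, a large degree sum) takes at most a
    quarter of the weightings, so some weighting avoids them all. *)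
Lemma random_graph_exists k b :
  4 * #|T| ^ k <= q.+1 ^ 'C(k, 2) ->
  4 * (#|T| ^ b * q ^ 'C(b, 2)) <= q.+1 ^ 'C(b, 2) -> 0 < #|T| ->
  exists w, [/\ forall A, #|A| = k -> exists x y, [/\ x \in A, y \in A, x != y & ~~ random_edge w x y],
    forall A, #|A| = b -> exists x y, [/\ x \in A, y \in A & random_edge w x y] &
    (\sum_x #|[set y | random_edge w x y]|) * q.+1 <= 4 * #|T| ^ 2].
Proof.
move=> hk hb T0.
set Q := #|{: weighting}|; have Q0 : 0 < Q by rewrite /Q card_ffun expn_gt0 card_ord.
have h1 := @card_constant_on_pairs [set ord0] k; rewrite cards1 exp1n muln1 in h1.
have {}h1 := h1 hk.
have h2 := @card_constant_on_pairs [set~ ord0] b.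
rewrite cardsC1 card_ord in h2; have {}h2 := h2 hb.
set bad1 := \bigcup_(A | _) _ in h1; set bad2 := \bigcup_(A | _) _ in h2.
pose bad3 := [set w | 4 * #|T| ^ 2 < (\sum_x #|[set y | random_edge w x y]|) * q.+1].
(* Markov's inequality: [bad3] asks for over four times the bound on the mean from [sum_degrees]. *)
have h3 : 4 * #|bad3| <= Q.
  have T2 : 0 < #|T| ^ 2 by rewrite expn_gt0 T0.
  rewrite -(leq_pmul2l T2); apply: leq_trans sum_degrees.
  rewrite big_distrl /= (bigID (mem bad3)) /=.
  apply: leq_trans (leq_addr _ _).
  rewrite mulnA (mulnC _ 4) mulnC -sum_nat_const; apply: leq_sum => w.
  by rewrite inE => /ltnW.
have [w wgood] : exists w, w \notin bad1 :|: bad2 :|: bad3.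
  apply/existsP; rewrite -negb_forall; apply/negP=> /forallP all_bad.
  have : Q <= #|bad1 :|: bad2 :|: bad3|.
    by apply/subset_leq_card/subsetP=> w _; exact: all_bad.
  have := leq_card_setU (bad1 :|: bad2) bad3; have := leq_card_setU bad1 bad2.
  by move=> [le12 _] [le123 _]; lia.
move: wgood; rewrite !in_setU !negb_or => /andP[/andP[good1 good2] good3].
exists w; split.
- move=> A cA; have : w \notin [set w : weighting | [forall e in pairs A, w e \in [set ord0]]].
    by apply: contra good1 => wA; apply/bigcupP; exists A => //; apply/eqP.
  rewrite inE => /forallPn[e]; rewrite negb_imply !inE => /andP[/andP[eA /cards2P[x [y [xy def_e]]]] we].
  move: eA; rewrite def_e subUset !sub1set => /andP[xA yA].
  by exists x, y; split=> //; rewrite /random_edge xy -def_e.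
- move=> A cA; have : w \notin [set w : weighting | [forall e in pairs A, w e \in [set~ ord0]]].
    by apply: contra good2 => wA; apply/bigcupP; exists A => //; apply/eqP.
  rewrite inE => /forallPn[e]; rewrite negb_imply !inE negbK => /andP[/andP[eA /cards2P[x [y [xy def_e]]]] we].
  move: eA; rewrite def_e subUset !sub1set => /andP[xA yA].
  by exists x, y; split=> //; rewrite /random_edge xy -def_e.
- by move: good3; rewrite inE -leqNgt.
Qed.
End RandomGraph.

(** Start from [2 * M] vertices. The degree sum is at most [16 * M ^ 2 / q.+1], so at most [M]
    vertices have degree above [D]; [M] of the others induce the graph. *)
Lemma ramsey_graph_exists M q k b D :
  4 * (2 * M) ^ k <= q.+1 ^ 'C(k, 2) ->
  4 * ((2 * M) ^ b * q ^ 'C(b, 2)) <= q.+1 ^ 'C(b, 2) ->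
  16 * M <= q.+1 * D -> 0 < M ->
  exists Y : rel 'I_M, [/\ symmetric Y,
    forall x, #|[set y | Y x y]| <= D,
    forall f : 'I_k -> 'I_M, injective f -> exists i j, i != j /\ ~~ Y (f i) (f j) &
    forall f : 'I_b -> 'I_M, injective f -> exists i j, i != j /\ Y (f i) (f j)].
Proof.
move=> hk hb hD M0.
have cT : #|'I_(2 * M)| = 2 * M by rewrite card_ord.
have [||| w [no_clique no_indep sumdeg]] := @random_graph_exists 'I_(2 * M) q k b; rewrite ?cT //.
  by rewrite muln_gt0.
pose deg x := #|[set y | random_edge w x y]|.
pose hi := [set x | D < deg x].
have card_hi : #|hi| <= M.
  have : #|hi| * (16 * M) <= (\sum_x deg x) * q.+1.
    rewrite big_distrl /= (bigID (mem hi)) /=; apply: leq_trans (leq_addr _ _).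
    rewrite -sum_nat_const; apply: leq_sum => x; rewrite inE => /ltnW leD.
    by apply: leq_trans hD _; rewrite mulnC leq_mul2r leD orbT.
  rewrite cT in sumdeg => le1; have := leq_trans le1 sumdeg.
  have -> : 4 * (2 * M) ^ 2 = M * (16 * M) by rewrite expnMn; lia.
  by rewrite leq_pmul2r // muln_gt0.
have le_lo : M <= #|~: hi| by have := cardsC hi; rewrite cT; lia.
have [B sB cB] := subset_of_card le_lo.
pose h (i : 'I_M) := enum_val (cast_ord (esym cB) i).
have h_inj : injective h by move=> i j /enum_val_inj /cast_ord_inj.
have deg_h i : deg (h i) <= D.
  by have := subsetP sB _ (enum_valP (cast_ord (esym cB) i)); rewrite !inE -leqNgt.
exists (fun x y => random_edge w (h x) (h y)); split.
- by move=> x y; rewrite /random_edge eq_sym setUC.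
- move=> x; apply: leq_trans (deg_h x); rewrite -(card_imset _ h_inj).
  apply/subset_leq_card/subsetP=> _ /imsetP[y + ->]; by rewrite !inE.
- move=> f f_inj; have hf_inj := inj_comp h_inj f_inj.
  have [|_ [_ [/imsetP[i _ ->] /imsetP[j _ ->] ij nY]]] := no_clique ((h \o f) @: setT).
    by rewrite card_imset // cardsT card_ord.
  by exists i, j; split=> //; apply: contra ij => /eqP->.
- move=> f f_inj; have hf_inj := inj_comp h_inj f_inj.
  have [|_ [_ [/imsetP[i _ ->] /imsetP[j _ ->] Yij]]] := no_indep ((h \o f) @: setT).
    by rewrite card_imset // cardsT card_ord.
  by exists i, j; split=> //; apply: contraTneq Yij => ->; rewrite /random_edge eqxx.
Qed.

(** * The hedgehog and a colouring that avoids it *)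

Definition hedgehog_edge b l (g : 'I_l -> 'I_b * 'I_b) (s : 'I_l) :
  {set 'I_b + 'I_l} := [set inl (g s).1; inl (g s).2; inr s].

(** Indexing the edges by the spikes puts every spike in exactly one edge. *)
Definition hedgehog b l (g : 'I_l -> 'I_b * 'I_b) : {set {set 'I_b + 'I_l}} :=
  [set hedgehog_edge g s | s : 'I_l].

Lemma hedgehog_is_3graph b l (g : 'I_l -> 'I_b * 'I_b) :
  (forall s, (g s).1 != (g s).2) -> is_3graph (hedgehog g).
Proof.
move=> gP _ /imsetP[s _ ->]; rewrite /hedgehog_edge setUC cardsU1 cards2 !inE /=.
by rewrite (inj_eq (@inl_inj _ _)) gP.
Qed.

Lemma hedgehog_is_gen_hedgehog b l (g : 'I_l -> 'I_b * 'I_b) :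
  (forall s, (g s).1 != (g s).2) -> gen_hedgehog (hedgehog g).
Proof.
move=> gP; exists [set v | if v is inl _ then true else false]; split.
  move=> _ /imsetP[s _ ->]; split.
    rewrite (_ : _ :&: _ = [set inl (g s).1; inl (g s).2]).
      by rewrite cards2 (inj_eq (@inl_inj _ _)) gP.
    by apply/setP=> -[i|i]; rewrite !inE ?orbF ?andbT ?andbF.
  rewrite (_ : _ :\: _ = [set inr s]) ?cards1 //.
  by apply/setP=> -[i|i]; rewrite !inE.
case=> [i|s]; rewrite !inE // => _.
rewrite (_ : [set _ in _ | _] = [set hedgehog_edge g s]) ?cards1 //.
apply/setP=> e; rewrite !inE; apply/andP/eqP => [[/imsetP[t _ ->]]|->].
  by rewrite !inE /= => /eqP[->].
by rewrite imset_f // !inE eqxx !orbT.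
Qed.

Lemma hedgehog_avoiding_colouring M b l k D (g : 'I_l -> 'I_b * 'I_b)
    (Y : rel 'I_M) (le_kb : k <= b) :
  symmetric Y -> (forall x, #|[set y | Y x y]| <= D) ->
  (forall f : 'I_k -> 'I_M, injective f -> exists i j, i != j /\ ~~ Y (f i) (f j)) ->
  (forall f : 'I_b -> 'I_M, injective f -> exists i j, i != j /\ Y (f i) (f j)) ->
  (forall i j, i != j -> exists s, g s = (i, j)) ->
  (forall i j : 'I_k, i != j ->
    2 * D < #|[set s | g s == (widen_ord le_kb i, widen_ord le_kb j)]|) ->
  ~ ramsey_prop M (hedgehog g) (hedgehog g).
Proof.
move=> Ysym Ydeg no_clique no_indep cover heavy.
move/(_ (fun e => [exists u in e, exists v in e, (u != v) && Y u v])).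
case=> -[f [f_inj homf]].
  have [|i [j [ij nY]]] := no_clique (fun i => f (inl (widen_ord le_kb i))).
    by move=> i j /f_inj [] /val_inj.
  have := heavy i j ij; rewrite ltnNge => /negP[].
  set x := f _ in nY; set y := f _ in nY.
  have -> : 2 * D = D + D by lia.
  apply: leq_trans (leq_add (Ydeg x) (Ydeg y)).
  apply: leq_trans (leq_card_setU _ _).
  have h_inj : injective (fun s => f (inr s)) by move=> s t /f_inj [].
  rewrite -(card_imset _ h_inj); apply/subset_leq_card/subsetP=> _ /imsetP[s + ->].
  rewrite inE => /eqP gs; have := homf _ (imset_f (hedgehog_edge g) (isT : s \in 'I_l)).
  (* The blue triple consists of [x], [y] and the image of the spike. It contains an edge of [Y]
     other than [{x, y}], so that image is a neighbour of [x] or of [y]. *)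
  have fP u : u \in f @: hedgehog_edge g s -> [\/ u = x, u = y | u = f (inr s)].
    case/imsetP=> v; rewrite !inE gs /= => /orP[/orP[]|] /eqP-> ->.
    - by constructor 1.
    - by constructor 2.
    - by constructor 3.
  move=> /existsP[u /andP[/fP hu /existsP[v /andP[/fP hv /andP[uv Yuv]]]]].
  rewrite !inE; move: uv Yuv.
  by case: hu hv => -> [] ->; rewrite ?eqxx // => _ Yuv; rewrite ?Yuv ?orbT //;
     move: Yuv nY; rewrite Ysym => -> //; rewrite ?orbT.
have [|i [j [ij Yij]]] := no_indep (fun i => f (inl i)).
  by move=> i j /f_inj [].
have [s gs] := cover i j ij.
have := homf _ (imset_f (hedgehog_edge g) (isT : s \in 'I_l)) => /existsP[].
exists (f (inl i)); rewrite imset_f; last by rewrite !inE gs eqxx.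
apply/existsP; exists (f (inl j)); rewrite imset_f; last by rewrite !inE gs eqxx orbT.
by rewrite Yij (inj_eq f_inj) (inj_eq (@inl_inj _ _)) ij.
Qed.

Lemma count_leq_card_nth (T : eqType) (x0 : T) (a : pred T) (s : seq T) l :
  size s <= l -> count a s <= #|[set i : 'I_l | a (nth x0 s i)]|.
Proof.
move=> le_sl; rewrite -sum1_count (big_nth x0) big_mkord sum1_card.
have w_inj : injective (widen_ord le_sl) by move=> i j /(congr1 val) /= /val_inj.
rewrite -(card_imset _ w_inj); apply/subset_leq_card/subsetP=> _ /imsetP[i ai ->].
by rewrite inE.
Qed.

(** The spikes read off a list: every ordered pair of distinct body vertices once, then [m] copies
    of the list of heavy pairs. *)
Lemma spike_assignment_exists b k l m (le_kb : k <= b) :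
  1 < b -> b * b + m * (k * k) <= l ->
  exists g : 'I_l -> 'I_b * 'I_b, [/\ forall s, (g s).1 != (g s).2,
    forall i j, i != j -> exists s, g s = (i, j) &
    forall i j : 'I_k, i != j ->
      m <= #|[set s | g s == (widen_ord le_kb i, widen_ord le_kb j)]|].
Proof.
move=> b1 hl.
pose w2 (p : 'I_k * 'I_k) := (widen_ord le_kb p.1, widen_ord le_kb p.2).
pose L := enum [pred p : 'I_b * 'I_b | p.1 != p.2].
pose H := [seq w2 p | p <- enum [pred p : 'I_k * 'I_k | p.1 != p.2]].
pose LH := L ++ flatten (nseq m H).
have szL : size L <= b * b.
  by rewrite -cardE; apply: leq_trans (max_card _) _; rewrite card_prod !card_ord.
have szH : size H <= k * k.
  by rewrite size_map -cardE; apply: leq_trans (max_card _) _; rewrite card_prod !card_ord.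
have szLH : size LH <= l.
  rewrite size_cat size_flatten /shape map_nseq sumn_nseq.
  by apply: leq_trans (leq_add szL _) hl; rewrite mulnC leq_mul2l szH orbT.
have LHP p : p \in LH -> p.1 != p.2.
  rewrite mem_cat mem_enum => /orP[//|/flattenP[s]].
  rewrite mem_nseq => /andP[_ /eqP->] /mapP[[i j]]; rewrite mem_enum inE /= => ij ->.
  by [].
(* Spikes beyond the end of the list go to the pair [(0, 1)], which is legitimate as [1 < b]. *)
pose p0 : 'I_b * 'I_b := (Ordinal (ltnW b1), Ordinal b1).
exists (fun s => nth p0 LH s); split.
- move=> s; have [lt_s|le_s] := ltnP s (size LH); last by rewrite nth_default.
  exact/LHP/mem_nth.
- move=> i j ij; have pLH : (i, j) \in LH by rewrite mem_cat mem_enum inE ij.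
  have lt_l : index (i, j) LH < l by apply: leq_trans szLH; rewrite index_mem.
  by exists (Ordinal lt_l); rewrite /= nth_index.
- move=> i j ij; set p := (_, _).
  apply: leq_trans (@count_leq_card_nth _ p0 (pred1 p) LH l szLH).
  rewrite count_cat count_flatten map_nseq sumn_nseq; apply: leq_trans (leq_addl _ _).
  rewrite leq_pmull // -has_count has_pred1; apply/mapP; exists (i, j) => //.
  by rewrite mem_enum.
Qed.

(** * Integer estimates and the choice of parameters *)

Lemma expn_succ_double q : 2 * q ^ q.+1 <= q.+1 ^ q.+1.
Proof.
(* Bernoulli's inequality [(1 + 1/q)^j >= 1 + j/q] without denominators, to be used at
   [j = q + 1]. *)
have bernoulli j : q ^ j * (q + j) <= q.+1 ^ j * q.
  elim: j => [|j IHj]; first by rewrite !expn0; lia.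
  rewrite !expnS; apply: (@leq_trans (q.+1 * (q ^ j * (q + j)))).
    by move: (q ^ j) => u; nia.
  by rewrite -mulnA leq_mul2l IHj orbT.
case: q bernoulli => [|q] bernoulli; first by [].
rewrite -(leq_pmul2r (ltn0Sn q)); apply: leq_trans (bernoulli _).
by rewrite -mulnA mulnCA leq_mul2l; apply/orP; right; lia.
Qed.

(** Each full block of [q.+1] factors gains a factor 2. This replaces the bound
    [(1 - p)^c <= exp(- p c)]. *)
Lemma expn_succ_exp2 q c : q ^ c * 2 ^ (c %/ q.+1) <= q.+1 ^ c.
Proof.
set t := c %/ _; rewrite {1 2}(divn_eq c q.+1) -/t; move: (c %% _) => r.
rewrite !expnD mulnAC mulnC; rewrite mulnC ![t * _]mulnC !expnM -expnMn.
apply: leq_mul; last by case: r => // r; rewrite leq_exp2r.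
case: t => // t; rewrite leq_exp2r // mulnC; exact: expn_succ_double.
Qed.

Lemma cube_leq_exp2 L : 120 <= L -> 64 * (64 * (64 * L ^ 3)) <= 2 ^ (L.-1 %/ 2).
Proof.
move=> leL; pose x := L %/ 16.
have leLx : L <= 2 ^ (4 + x).
  by rewrite expnD; have := @ltn_expl 2 x isT; move: (2 ^ x) => u; rewrite /x; lia.
apply: (@leq_trans (2 ^ 6 * (2 ^ 6 * (2 ^ 6 * (2 ^ (4 + x)) ^ 3)))).
  by rewrite !leq_mul2l leq_exp2r.
by rewrite -expnM -!expnD leq_exp2l // /x; lia.
Qed.

Lemma hedgehog_parameters n L s :
  n <= 2 ^ L -> s * s <= n < s.+1 * s.+1 -> 0 < L -> 64 * (64 * (64 * L ^ 3)) <= s ->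
  exists b q m D M, [/\
    [/\ 16 <= b, b * b + m * (16 * 16) <= n - b & 2 * D < m],
    [/\ 4 * (2 * M) ^ 16 <= q.+1 ^ 'C(16, 2),
        4 * ((2 * M) ^ b * q ^ 'C(b, 2)) <= q.+1 ^ 'C(b, 2),
        16 * M <= q.+1 * D & 0 < M] &
    n * s.+1 <= 32 * (32 * (64 * (64 * (L * M))))].
Proof.
move=> nL /andP[s_lo s_hi] L0 sL.
have L3 : L <= L ^ 3 by rewrite -{1}(expn1 L) leq_pexp2l.
have sL1 : 64 * (64 * (64 * L)) <= s by lia.
have s_big : 64 * 64 <= s by lia.
have ns : 64 * (64 * s) <= n by nia.
pose b := s %/ 2; pose q1 := b.-1 %/ (4 * L).
pose m := n %/ 512; pose D := m.-1 %/ 2; pose M := q1 * D %/ 16.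
have sb : s.+1 <= 4 * b by rewrite /b; lia.
have bs : 2 * b <= s by rewrite /b; lia.
have bq : b <= 8 * L * q1.
  have := leq_divM b.-1 (4 * L); have := ltn_ceil b.-1 (_ : 0 < 4 * L).
  rewrite -/q1 muln_gt0 L0 => /(_ isT); nia.
have qb : q1 * (4 * L) <= b.-1 by exact: leq_divM.
have q0 : 0 < q1 by nia.
have sq : s.+1 <= 32 * L * q1 by nia.
have nD : n <= 64 * (64 * D) by rewrite /D /m; lia.
have MqD : 16 * M <= q1 * D by rewrite mulnC; exact: leq_divM.
have D30 : 30 <= D by lia.
have qDM : q1 * D <= 32 * M by have := leq_mul q0 D30; rewrite /M; lia.
have Mn : 8 * M <= n ^ 2.
  have h1 : q1 <= n by nia.
  have h2 : D <= n by rewrite /D /m; lia.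
  have := leq_mul h1 h2; rewrite mulnn; lia.
have le4 j : 0 < j -> 4 <= 4 ^ j by move=> j0; rewrite -{1}(expn1 4) leq_exp2l.
exists b, q1.-1, m, D, M; rewrite prednK //; split; first split.
- by lia.
- have : 4 * (b * b) <= n by nia.
  have : m * 512 <= n by exact: leq_divM.
  lia.
- by rewrite /D /m; lia.
- split=> //; last by nia.
    (* [q^3 >= n] and [2M <= n^2], so the clique count [n^32] is beaten by [q^120 >= n^40]. *)
    have q3 : n <= q1 ^ 3.
      have h : (32 * L) ^ 3 <= s.+1.
        by rewrite expnMn !(expnS 32) expn0; move: (L ^ 3) sL => u; lia.
      have : (32 * L) ^ 3 * n <= (32 * L) ^ 3 * q1 ^ 3.
        rewrite -expnMn; apply: (@leq_trans (s.+1 ^ 3)); last by rewrite leq_exp2r.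
        by rewrite expnS -mulnn; apply: leq_mul => //; exact: ltnW.
      by rewrite leq_pmul2l // expn_gt0 muln_gt0 L0.
    have -> : 'C(16, 2) = 3 * 40 by [].
    rewrite expnM; apply: (@leq_trans (n ^ 40)); last by rewrite leq_exp2r.
    apply: (@leq_trans ((n ^ 2) ^ 16)); last by rewrite -expnM leq_pexp2l //; lia.
    apply: (@leq_trans (4 ^ 16 * (2 * M) ^ 16)); first by apply: leq_mul (le4 _ _) (leqnn _).
    by rewrite -expnMn leq_exp2r //; lia.
  (* Independent sets: the exponent ['C(b, 2) %/ q1] is at least [2 * L * b], and [2 ^ (2 * L * b)
     >= n ^ (2 * b) >= (8 * M) ^ b]. *)
  have leC : 2 * L * b * q1 <= 'C(b, 2).
    rewrite bin2; suff : 4 * L * b * q1 <= b * b.-1 by lia.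
    by have := leq_mul (leqnn b) qb; lia.
  have := expn_succ_exp2 q1.-1 'C(b, 2); rewrite prednK // => hq.
  apply: leq_trans hq; rewrite mulnA mulnC leq_mul2l; apply/orP; right.
  apply: (@leq_trans (2 ^ (2 * L * b))); last by rewrite leq_exp2l // leq_divRL.
  have b0 : 0 < b by lia.
  apply: (@leq_trans ((8 * M) ^ b)).
    rewrite (_ : 8 * M = 4 * (2 * M)); last by lia.
    by rewrite [X in _ <= X]expnMn; apply: leq_mul (le4 _ b0) (leqnn _).
  rewrite expnM leq_exp2r //; apply: (leq_trans Mn).
  by rewrite mulnC expnM leq_exp2r.
(* The constants multiply those of [nD], [sq] and [qDM]. *)
- apply: (@leq_trans (64 * (64 * D) * (32 * L * q1))); first exact: leq_mul.
  have := leq_mul (leqnn L) qDM; lia.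
Qed.

(** * Passage to real numbers and conclusion *)

Lemma ln_exp2 k : (INR k / 2 <= ln (INR (2 ^ k)))%R.
Proof.
elim: k => [|k IHk]; first by rewrite expn0 /= ln_1; lra.
have pos : (0 < INR (2 ^ k))%R by apply: lt_0_INR; apply/ltP; rewrite expn_gt0.
rewrite expnS mult_INR ln_mult //; last by rewrite /=; lra.
by have := ln_lt_2; rewrite (S_INR k) (_ : INR 2 = 2%R) //; lra.
Qed.

Lemma Rpower_three_halves x : (0 < x)%R -> Rpower x (3 / 2) = (x * sqrt x)%R.
Proof.
move=> x0; have -> : (3 / 2 = 1 + / 2)%R by lra.
by rewrite Rpower_plus Rpower_1 // Rpower_sqrt.
Qed.

(** Here [s.+1] bounds [sqrt n] from above, and [ln n > (L - 1) / 2 >= L / 4], which accounts for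
    the factor 4 in the constant. *)
Lemma three_halves_bound n s L M :
  n < s.+1 * s.+1 -> 1 < L -> 2 ^ L.-1 < n ->
  n * s.+1 <= 32 * (32 * (64 * (64 * (L * M)))) ->
  (/ (4 * (32 * (32 * (64 * 64)))) * (Rpower (INR n) (3 / 2) / ln (INR n))
     <= INR M)%R.
Proof.
move=> s_hi L1 nlo bound.
have n0 : (0 < INR n)%R by apply: lt_0_INR; lia.
have sqrt_s : (sqrt (INR n) <= INR s.+1)%R.
  rewrite -(sqrt_square (INR s.+1)); last exact: pos_INR.
  by apply: sqrt_le_1_alt; rewrite -mult_INR; apply: le_INR; lia.
have ln_lo : (INR L <= 4 * ln (INR n))%R.
  apply: (@Rle_trans _ (4 * (INR L.-1 / 2))).
    have -> : L = L.-1.+1 by lia.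
    have : (1 <= INR L.-1)%R by apply: (le_INR 1); lia.
    by rewrite S_INR /=; lra.
  have h := ln_exp2 L.-1.
  have : (ln (INR (2 ^ L.-1)) < ln (INR n))%R.
    apply: ln_increasing; first by apply: lt_0_INR; apply/ltP; rewrite expn_gt0.
    by apply: lt_INR; apply/ltP.
  lra.
have ln0 : (0 < ln (INR n))%R.
  have : (0 < INR L)%R by apply: lt_0_INR; lia.
  lra.
have boundR : (INR n * INR s.+1 <= 32 * (32 * (64 * (64 * (INR L * INR M)))))%R.
  move/leP/le_INR: bound; rewrite !mult_INR.
  have -> : INR 32 = 32%R by rewrite INR_IZR_INZ.
  by have -> : INR 64 = 64%R by rewrite INR_IZR_INZ.
rewrite Rpower_three_halves //.
apply: (Rmult_le_reg_l (4 * (32 * (32 * (64 * 64))) * ln (INR n))); first lra.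
have -> : (4 * (32 * (32 * (64 * 64))) * ln (INR n) *
    (/ (4 * (32 * (32 * (64 * 64)))) * (INR n * sqrt (INR n) / ln (INR n))) =
  INR n * sqrt (INR n))%R by field; lra.
have le1 : (INR n * sqrt (INR n) <= INR n * INR s.+1)%R.
  by apply: Rmult_le_compat_l; lra.
have le2 := Rmult_le_compat_r _ _ _ (pos_INR M) ln_lo.
lra.
Qed.

Lemma hedgehog_with_large_ramsey n L s :
  n <= 2 ^ L -> s * s <= n < s.+1 * s.+1 -> 0 < L -> 64 * (64 * (64 * L ^ 3)) <= s ->
  exists (V : finType) (E : {set {set V}}) M,
    [/\ #|V| = n, is_3graph E, gen_hedgehog E, M < ramsey E &
        n * s.+1 <= 32 * (32 * (64 * (64 * (L * M))))].
Proof.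
move=> nL hs L0 sL.
have [b [q [m [D [M [[b16 hl Dm] [h1 h2 h3 M0] bound]]]]]] :=
  hedgehog_parameters nL hs L0 sL.
have [Y [Ysym Ydeg no_clique no_indep]] := ramsey_graph_exists h1 h2 h3 M0.
have [|g [gP cover heavy]] := @spike_assignment_exists b 16 (n - b) m b16 _ hl.
  exact: leq_trans b16.
have E3 := hedgehog_is_3graph gP.
exists ('I_b + 'I_(n - b))%type, (hedgehog g), M; split=> //.
- have le_bn : b <= n.
    have b_sq : b <= b * b by rewrite leq_pmulr // (leq_trans _ b16).
    apply: leq_trans b_sq _; apply: leq_trans (leq_subr b n).
    exact: leq_trans (leq_addr _ _) hl.
  by rewrite card_sum !card_ord subnKC.
- exact: hedgehog_is_gen_hedgehog.
apply: ramsey_lower_bound => //.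
apply: (@hedgehog_avoiding_colouring M b (n - b) 16 D g Y b16) => // i j ij.
exact: leq_trans Dm (heavy i j ij).
Qed.

Theorem theorem1p1 :
  exists c : R, (0 < c)%R /\
  exists n0 : nat, forall n : nat, (n0 <= n)%N ->
    exists (V : finType) (E : {set {set V}}),
      #|V| = n /\ is_3graph E /\ gen_hedgehog E /\
      (c * (Rpower (INR n) (3 / 2) / ln (INR n)) <= INR (ramsey E))%R.
Proof.
exists (/ (4 * (32 * (32 * (64 * 64)))))%R; split; first lra.
(* This forces [L >= 120], as [cube_leq_exp2] requires. *)
exists (2 ^ 120) => n n_big.
have n1 : 1 < n by apply: leq_trans n_big; rewrite (@ltn_exp2l 2 0 120).
have /andP[nlo nhi] := @up_log_bounds 2 n isT n1.
set L := up_log 2 n in nlo nhi.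
have L_big : 120 <= L by rewrite -(@leq_exp2l 2) //; exact: leq_trans n_big nhi.
clear n_big.
have [s hs] : exists s, s * s <= n < s.+1 * s.+1.
  by exists (Nat.sqrt n); have := Nat.sqrt_spec n (Nat.le_0_l n); lia.
have s_hi : n < s.+1 * s.+1 by case/andP: hs.
(* The square of [2 ^ (L.-1 %/ 2)] is at most [2 ^ L.-1 < n < s.+1 ^ 2], so this power is at most
   [s]. *)
have sL : 64 * (64 * (64 * L ^ 3)) <= s.
  apply: (leq_trans (cube_leq_exp2 L_big)); rewrite -ltnS -ltn_sqr -expnM.
  apply: (@leq_ltn_trans n); last by rewrite -mulnn.
  by apply: ltnW; apply: leq_ltn_trans nlo; rewrite leq_exp2l // leq_divM.
have L1 : 1 < L by apply: leq_trans L_big.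
have [V [E [M [cV E3 hE ltM bound]]]] := hedgehog_with_large_ramsey nhi hs (ltnW L1) sL.
exists V, E; do 3!split=> //.
apply: Rle_trans (three_halves_bound s_hi L1 nlo bound) _.
exact/le_INR/leP/ltnW.
Qed.
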